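(* Let $\alpha\in(0,1)$. For every real $v$ the limit $$\lim_{t\to\infty}\psi_\alpha(v,t),\qquad \psi_\alpha(v,t):=\mathrm P\Big\{\inf_{0\le s\le t}R_\alpha(s)\le v\Big\},$$ does not depend on $\alpha$ and coincides with the classical ruin probability, i.e. it equals $$\lim_{t\to\infty}\mathrm P\Big\{\inf_{0\le s\le t}R_1(s)\le v\Big\}.$$ Here $R_\alpha$ is the fractional risk process and $R_1$ the classical risk process, both with the same $u,\mu,\lambda,\rho$ and the same claim size distribution.
   Context: For $\alpha\in(0,1)$, $L_\alpha=\{L_\alpha(t),t\ge0\}$ is the $\alpha$-stable subordinator: a non-decreasing càdlàg Lévy process started at $0$ with $\mathrm E\,e^{-sL_\alpha(t)}=e^{-ts^\alpha}$, $s\ge0$. The inverse stable subordinator is $Y_\alpha(t)=\inf\{w\ge0: L_\alpha(w)>t\}$, and $Y_1(t):=t$. $N=\{N(t),t\ge0\}$ is a homogeneous Poisson process with rate $\lambda>0$, independent of $Y_\alpha$, and $N_\alpha(t):=N(Y_\alpha(t))$ is the fractional Poisson process ($N_1=N$). Claim sizes $X_1,X_2,\dots$ are iid with mean $\mu>0$, and the sequence $(X_i)$ is independent of $(N,Y_\alpha)$. With initial capital $u>0$ and safety loading $\rho\ge0$, the (fractional) risk process is $$R_\alpha(t)=u+\mu\lambda(1+\rho)Y_\alpha(t)-\sum_{i=1}^{N_\alpha(t)}X_i,\qquad t\ge0;$$ for $\alpha=1$ this is the classical risk process. *)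

(* Defs.v *)
From HB Require Import structures.
From mathcomp Require Import all_boot all_order all_algebra.
From mathcomp Require Import all_classical all_reals all_analysis.

Set Implicit Arguments.
Unset Strict Implicit.
Unset Printing Implicit Defensive.

Import Order.TTheory GRing.Theory Num.Theory.
Import numFieldNormedType.Exports.

Local Open Scope classical_set_scope.
Local Open Scope ring_scope.

(* Throughout, a process indexed by time is a function on all of R of which
   only the restriction to [0, +oo[ is ever used. *)

Section Independence.
Context {d : measure_display} {T : measurableType d} {R : realType}.
Variable P : probability T R.

Definition mutually_independent (I : eqType) (X : I -> T -> R) : Prop :=
  forall (s : seq I) (B : I -> set R), uniq s ->
    (forall i, measurable (B i)) ->
    P (\bigcap_(i in [set` s]) (X i @^-1` B i)) =
    (\prod_(i <- s) P (X i @^-1` B i))%E.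

Definition sigma_family d' (T' : measurableType d') (I : Type)
    (D : set I) (X : I -> T -> T') : set (set T) :=
  <<s \bigcup_(i in D) g_sigma_algebra_preimage (X i) >>.

Definition independent_systems (F G : set (set T)) : Prop :=
  forall A B, F A -> G B -> P (A `&` B) = (P A * P B)%E.

Definition iid (X : nat -> {RV P >-> R}) : Prop :=
  mutually_independent (fun i => X i : T -> R) /\
  forall i B, measurable B -> distribution P (X i) B = distribution P (X 0%N) B.

End Independence.

Section Processes.
Context {d : measure_display} {T : measurableType d} {R : realType}.
Variable P : probability T R.

Definition cadlag (f : R -> R) : Prop :=
  (forall t : R, 0 <= t -> f x @[x --> t^'+] --> f t) /\
  (forall t : R, 0 < t -> cvg (f x @[x --> t^'-])).

Definition nondecreasing_path (f : R -> R) : Prop :=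
  forall s t : R, 0 <= s -> s <= t -> f s <= f t.

Definition independent_increments (Z : R -> T -> R) : Prop :=
  forall (n : nat) (t : nat -> R), 0 <= t 0%N ->
    {homo t : i j / (i <= j)%N >-> i <= j} ->
    mutually_independent P
      (fun (i : 'I_n) w => Z (t i.+1) w - Z (t i) w).

Definition stationary_increments (Z : R -> T -> R) : Prop :=
  forall (s h : R) (B : set R), 0 <= s -> 0 <= h -> measurable B ->
    P ((fun w => Z (s + h) w - Z s w) @^-1` B) = P (Z h @^-1` B).

(* The path properties hold for every outcome, not just almost every one. *)
Definition levy_process (Z : R -> {RV P >-> R}) : Prop :=
  [/\ forall w, Z 0 w = 0,
      forall w, cadlag (Z ^~ w),
      independent_increments (fun t => Z t : T -> R) &
      stationary_increments (fun t => Z t : T -> R)].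

Definition stable_subordinator (alpha : R) (L : R -> {RV P >-> R}) : Prop :=
  [/\ levy_process L,
      forall w, nondecreasing_path (L ^~ w) &
      forall s t : R, 0 <= s -> 0 <= t ->
        'E_P[fun w => expR (- s * L t w)]%E = (expR (- t * s `^ alpha))%:E].

(* For a stable subordinator the set below is nonempty for all t outside a
   null event; on that event inf takes its default value 0 on the empty set. *)
Definition inverse_process (L : R -> T -> R) (t : R) (w : T) : R :=
  inf [set x | 0 <= x /\ t < L x w].

(* poisson_pmf is only meaningful for a positive parameter, hence s < t. *)
Definition poisson_process (lambda : R) (N : R -> {RV P >-> nat}) : Prop :=
  [/\ forall w, N 0 w = 0%N,
      forall w, nondecreasing_path (fun t => (N t w)%:R),
      forall w, cadlag (fun t => (N t w)%:R),
      independent_increments (fun t w => (N t w)%:R) &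
      forall (s t : R) (k : nat), 0 <= s -> s < t ->
        P [set w | N t w = (N s w + k)%N] =
        (poisson_pmf (lambda * (t - s)) k)%:E].

End Processes.

Section RiskProcess.
Context {d : measure_display} {T : measurableType d} {R : realType}.

(* The random ingredients of a risk process run on the clock Y: a Poisson
   process N independent of Y, and iid integrable claims independent of the
   pair (N, Y). *)
Definition risk_model (P : probability T R) (lambda mu : R)
    (N : R -> {RV P >-> nat}) (Y : R -> T -> R) (X : nat -> {RV P >-> R}) :
    Prop :=
  let time := [set t : R | 0 <= t] in
  let sigmaN := sigma_family time (fun t => N t : T -> nat) in
  let sigmaY := sigma_family time Y in
  let sigmaX := sigma_family setT (fun i => X i : T -> R) in
  [/\ poisson_process lambda N,
      independent_systems P sigmaN sigmaY,
      iid X,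
      P.-integrable setT (EFin \o X 0%N) /\ 'E_P[X 0%N]%E = mu%:E &
      independent_systems P sigmaX <<s sigmaN `|` sigmaY >>].

(* The clock of the classical risk process. *)
Definition identity_clock (t : R) (w : T) : R := t.

(* The claims X_1, X_2, ... are numbered from 0. *)
Definition risk_process (u mu lambda rho : R) (N : R -> T -> nat)
    (Y : R -> T -> R) (X : nat -> T -> R) (t : R) (w : T) : R :=
  u + mu * lambda * (1 + rho) * Y t w - \sum_(i < N (Y t w) w) X i w.

Definition ruin_probability (P : probability T R) (Risk : R -> T -> R)
    (v t : R) : \bar R :=
  P [set w | (ereal_inf [set (Risk s w)%:E | s in `[0%R, t]%classic] <= v%:E)%E].

End RiskProcess.

(* Main.v *)
(* The fractional process is the classical surplus C of the pair (N, X)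
   evaluated at the clock Y, the right inverse of L. Both ruin probabilities
   are nondecreasing in the horizon, hence converge to the probability of
   ultimate undershoot. Outside a null set L is strictly increasing and
   unbounded (Chernoff bounds from its Laplace transform), so Y maps [0, +oo[
   onto itself and C o Y undershoots v at some horizon iff C does.
   Ultimate undershoot of C depends, by right continuity, on (N, X) only
   through dyadic times, and its probability is therefore determined by the
   law of the dyadic increments of N and of X, which is the same in both models
   by the pi-lambda theorem. *)
Require Import Defs.
From HB Require Import structures.
From mathcomp Require Import all_boot all_order all_algebra.
From mathcomp Require Import all_classical all_reals all_analysis.
From mathcomp Require Import measurable_realfun lra.

Set Implicit Arguments.
Unset Strict Implicit.
Unset Printing Implicit Defensive.

Import Order.TTheory GRing.Theory Num.Theory.
Import numFieldNormedType.Exports.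

Local Open Scope classical_set_scope.
Local Open Scope ring_scope.

(** * Measurability of countably described events and of randomly indexed functions *)

Section Measurability.
Context {d : measure_display} {T : measurableType d} {R : realType}.

Lemma measurable_exists (A : nat -> set T) : (forall n, measurable (A n)) ->
  measurable [set w | exists n, A n w].
Proof.
move=> mA; rewrite (_ : mkset _ = \bigcup_n A n); first exact: bigcupT_measurable.
by apply/seteqP; split=> w [n]; [exists n|move=> _; exists n].
Qed.

Lemma measurable_forall (A : nat -> set T) : (forall n, measurable (A n)) ->
  measurable [set w | forall n, A n w].
Proof.
move=> mA; rewrite (_ : mkset _ = \bigcap_n A n); first exact: bigcapT_measurable.
by apply/seteqP; split=> w Aw n; [move=> _|]; exact: Aw.
Qed.

Lemma measurable_guard (Q : Prop) (A : set T) : (Q -> measurable A) ->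
  measurable [set w | Q /\ A w].
Proof.
move=> mA; have [q|nq] := pselect Q.
  rewrite (_ : mkset _ = A); first exact: mA.
  by apply/seteqP; split=> w; [case|].
rewrite (_ : mkset _ = set0) //.
by apply/seteqP; split=> w //; case.
Qed.

Lemma measurable_implies (Q : Prop) (A : set T) : (Q -> measurable A) ->
  measurable [set w | Q -> A w].
Proof.
move=> mA; have [q|nq] := pselect Q.
  rewrite (_ : mkset _ = A); first exact: mA.
  by apply/seteqP; split=> w; [move=> /(_ q)|move=> ? _].
rewrite (_ : mkset _ = setT) //.
by apply/seteqP; split=> w // _ /nq.
Qed.

Lemma measurable_lt_fun (f g : T -> R) :
  measurable_fun setT f -> measurable_fun setT g ->
  measurable [set w | f w < g w].
Proof.
move=> mf mg; rewrite -[X in measurable X]setTI.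
exact: (measurable_fun_ltr mf mg measurableT (Y := [set true])).
Qed.

Lemma measurable_le_fun (f g : T -> R) :
  measurable_fun setT f -> measurable_fun setT g ->
  measurable [set w | f w <= g w].
Proof.
move=> mf mg; rewrite -[X in measurable X]setTI.
exact: (measurable_fun_ler mf mg measurableT (Y := [set true])).
Qed.

Lemma measurable_fun_lt_cst (f : T -> R) :
  (forall a, measurable [set w | f w < a]) -> measurable_fun setT f.
Proof.
move=> mf; apply: (measurability _ (RGenInftyO.measurableE R)).
move=> _ [_ [a ->] <-]; rewrite setTI.
rewrite (_ : _ @^-1` _ = [set w | f w < a]).
  exact: mf.
by apply/seteqP; split=> w /=; rewrite in_itv.
Qed.

(* Covers both random sums and processes sampled at discretised random times. *)
Lemma measurable_fun_random_index (M : T -> nat) (F : nat -> T -> R) :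
  measurable_fun setT M -> (forall n, measurable_fun setT (F n)) ->
  measurable_fun setT (fun w => F (M w) w).
Proof.
move=> mM mF; apply: measurable_fun_lt_cst => a.
rewrite (_ : mkset _ = [set w | exists n, M w = n /\ F n w < a]).
  apply: measurable_exists => n; apply: measurableI.
    by rewrite -[X in measurable X]setTI; exact: (mM measurableT [set n]).
  exact: measurable_lt_fun.
by apply/seteqP; split=> w /= => [|[n [<-]]//]; exists (M w).
Qed.

Lemma measurable_fun_truncn (f : T -> R) : (forall w, 0 <= f w) ->
  measurable_fun setT f -> measurable_fun setT (fun w => Num.trunc (f w)).
Proof.
move=> f0 mf _ B _; rewrite setTI.
rewrite (_ : _ @^-1` B = [set w | exists n, B n /\ (n%:R <= f w /\ f w < n.+1%:R)]).
  apply: measurable_exists => n; apply: measurable_guard => _.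
  by apply: measurableI; [exact: measurable_le_fun|exact: measurable_lt_fun].
apply/seteqP; split=> w /=.
  move=> Bw; exists (Num.trunc (f w)); split => //.
  by have /andP[] := truncn_itv (f0 w).
by move=> [n [Bn [h1 h2]]]; rewrite (@truncn_def _ _ n) ?h1 ?h2.
Qed.

End Measurability.

(** * Dyadic times and approximation from the right *)

Definition dyadic {R : realType} (m j : nat) : R := j%:R / 2 ^+ m.

Section Dyadic.
Context {R : realType}.

Lemma dyadic_ge0 m j : 0 <= dyadic m j :> R.
Proof. by rewrite /dyadic divr_ge0 // exprn_ge0. Qed.

Lemma dyadic0 m : dyadic m 0 = 0 :> R.
Proof. by rewrite /dyadic mul0r. Qed.

Lemma dyadic_nat j : dyadic 0 j = j%:R :> R.
Proof. by rewrite /dyadic expr0 divr1. Qed.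

Lemma dyadicSl m j : dyadic m.+1 j.*2 = dyadic m j :> R.
Proof.
rewrite /dyadic exprS -muln2 natrM invfM mulrA; congr (_ / _).
by rewrite mulfK.
Qed.

Lemma dyadic_le m i j : (i <= j)%N -> dyadic m i <= dyadic m j :> R.
Proof. by move=> ij; rewrite /dyadic ler_pM2r ?invr_gt0 ?exprn_gt0 // ler_nat. Qed.

Lemma dyadic_lt m i j : (i < j)%N -> dyadic m i < dyadic m j :> R.
Proof. by move=> ij; rewrite /dyadic ltr_pM2r ?invr_gt0 ?exprn_gt0 // ltr_nat. Qed.

(** The successor makes the approximating time strictly larger than [s], even when [s] is itself
    dyadic, at a distance of at most one mesh. *)
Definition dyadic_up (m : nat) (s : R) : nat := (Num.trunc (s * 2 ^+ m)).+1.

Lemma dyadic_upP m (s : R) : 0 <= s ->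
  s < dyadic m (dyadic_up m s) <= s + 2 ^- m.
Proof.
move=> s0; have p0 : 0 < 2 ^+ m :> R by rewrite exprn_gt0.
have sp0 : 0 <= s * 2 ^+ m by rewrite mulr_ge0 // ltW.
have /andP[h1 h2] := truncn_itv sp0.
rewrite /dyadic /dyadic_up ltr_pdivlMr // h2 /= ler_pdivrMr // mulrDl mulVf ?gt_eqF //.
by rewrite -natr1 lerD2r.
Qed.

Lemma exp2N_lt (e : R) : 0 < e -> exists m : nat, forall n, (m <= n)%N -> 2 ^- n < e.
Proof.
move=> e0; exists (Num.trunc e^-1).+1 => n mn.
rewrite -[e]invrK ltf_pV2 ?posrE ?invr_gt0 ?exprn_gt0 //.
apply: (lt_le_trans (truncnS_gt _)).
by rewrite -natrX ler_nat (leq_trans mn) // ltnW // ltn_expl.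
Qed.

Lemma dyadic_dense (s t : R) : 0 <= s -> s < t ->
  exists m j, s < dyadic m j < t.
Proof.
move=> s0 st; have [m hm] := @exp2N_lt (t - s) ltac:(by rewrite subr_gt0).
have /andP[h1 h2] := dyadic_upP m s0.
exists m, (dyadic_up m s); rewrite h1 /=.
by apply: (le_lt_trans h2); rewrite -ltrBrDl; exact: hm.
Qed.

End Dyadic.

(** * Right-continuous paths and their running infimum *)

Definition right_continuous {R : realType} (f : R -> R) : Prop :=
  forall s, 0 <= s -> forall e, 0 < e ->
  exists2 r, 0 < r & forall x, s <= x -> x < s + r -> `|f x - f s| < e.

Section RightContinuous.
Context {R : realType}.
Implicit Types f : R -> R.

Lemma cadlag_right_continuous f : cadlag f -> right_continuous f.
Proof.
move=> [+ _] s s0 e e0 => /(_ s s0) /cvgrPdist_lt /(_ e e0).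
rewrite near_withinE => -[r /= r0 hr]; exists r => // x.
rewrite le_eqVlt => /orP[/eqP <- _|sx xr]; first by rewrite subrr normr0.
rewrite distrC; apply: hr => //=.
by rewrite ltr0_norm ?subr_lt0 // opprB ltrBlDl.
Qed.

(** The last hypothesis keeps [g x] to the right of [g s], the only side on which [f] is
    controlled. *)
Lemma right_continuous_comp f g : right_continuous f -> right_continuous g ->
  (forall s, 0 <= s -> 0 <= g s) ->
  (forall s, 0 <= s -> exists2 r, 0 < r & forall x, s <= x -> x < s + r -> g s <= g x) ->
  right_continuous (f \o g).
Proof.
move=> cf cg g0 gle s s0 e e0 /=.
have [r r0 hr] := cf _ (g0 _ s0) e e0.
have [r1 r10 hr1] := cg _ s0 r r0.
have [r2 r20 hr2] := gle _ s0.
exists (Num.min r1 r2); first by rewrite lt_min r10.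
move=> x sx; rewrite -ltrBlDl lt_min !ltrBlDl => /andP[x1 x2].
apply: hr; first exact: hr2.
by have := hr1 _ sx x1; rewrite ltr_norml => /andP[_]; rewrite ltrBlDl.
Qed.

(** The infimum need not be attained, so [<= v] is relaxed to [< v + 1/(k+1)] for every [k]. A
    strict inequality at some [s < t] persists on an interval to the right of [s], which contains a
    dyadic time below [t]. *)
Lemma inf_le_dyadic f (t v : R) : 0 <= t -> right_continuous f ->
  (ereal_inf [set (f s)%:E | s in `[0%R, t]%classic] <= v%:E)%E <->
  forall k : nat, f t < v + k.+1%:R^-1 \/
    exists m j, dyadic m j <= t /\ f (dyadic m j) < v + k.+1%:R^-1.
Proof.
move=> t0 cf; split=> [fv k|fv].
  have vk : v < v + k.+1%:R^-1 by rewrite ltrDl invr_gt0.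
  have : (ereal_inf [set (f s)%:E | s in `[0%R, t]%classic] < (v + k.+1%:R^-1)%:E)%E.
    by apply: (le_lt_trans fv); rewrite lte_fin.
  move=> /ereal_inf_lt[y [s /=]]; rewrite in_itv /= => /andP[s0].
  rewrite le_eqVlt => /orP[/eqP -> <-|st <-]; rewrite lte_fin => fs; first by left.
  right.
  have [r r0 hr] := cf s s0 (v + k.+1%:R^-1 - f s) ltac:(by rewrite subr_gt0).
  have [m [j]] := @dyadic_dense R s (Num.min t (s + r)) s0
    ltac:(by rewrite lt_min st ltrDl).
  rewrite lt_min => /and3P[sd dt dr]; exists m, j; split; first exact: ltW.
  have := hr _ (ltW sd) dr; rewrite ltr_norml => /andP[_].
  by rewrite ltrD2r.
apply/lee_addgt0Pr => e e0.
have k_e : (Num.trunc e^-1).+1%:R^-1 < e.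
  by rewrite -[ltRHS]invrK ltf_pV2 ?posrE ?invr_gt0 // truncnS_gt.
have vke : v + (Num.trunc e^-1).+1%:R^-1 <= v + e by rewrite lerD2l ltW.
apply: ge_ereal_inf; case: (fv (Num.trunc e^-1)) => [ft|[m [j [dt fd]]]].
  exists (f t)%:E; first by exists t => //=; rewrite in_itv /= t0 lexx.
  by rewrite -EFinD lee_fin (le_trans (ltW ft)).
exists (f (dyadic m j))%:E.
  by exists (dyadic m j) => //=; rewrite in_itv /= dt dyadic_ge0.
by rewrite -EFinD lee_fin (le_trans (ltW fd)).
Qed.

End RightContinuous.

(** * Sampling at random times and undershoot events *)

Section Sampling.
Context {d : measure_display} {T : measurableType d} {R : realType}.
Variable Z : R -> T -> R.
Hypothesis mZ : forall m j, measurable_fun setT (Z (dyadic m j)).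

(** Rounding [Y] up to the mesh [2^-m] gives a random index into countably many measurable
    functions; right continuity makes these samples converge pointwise. *)
Lemma measurable_sample (Y : T -> R) : (forall w, right_continuous (Z ^~ w)) ->
  (forall w, 0 <= Y w) -> measurable_fun setT Y ->
  measurable_fun setT (fun w => Z (Y w) w).
Proof.
move=> cZ Y0 mY.
apply: (@measurable_fun_cvg _ _ _ _
  (fun m w => Z (dyadic m (dyadic_up m (Y w))) w)).
  move=> m; apply: (@measurable_fun_random_index _ _ _
    (fun w => dyadic_up m (Y w)) (fun j => Z (dyadic m j))) => //.
  apply: (@measurableT_comp _ _ _ _ _ _ S _
    (fun w => Num.trunc (Y w * 2 ^+ m))) => //.
  apply: measurable_fun_truncn => [w|].
    by rewrite mulr_ge0 // exprn_ge0.
  exact: measurable_funM.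
move=> w _; apply/cvgrPdist_lt => e e0.
have [r r0 hr] := cZ w _ (Y0 w) e e0.
have [m hm] := exp2N_lt r0.
exists m => // n /= mn; rewrite distrC.
have /andP[h1 h2] := dyadic_upP n (Y0 w).
apply: hr; first exact: ltW.
by apply: (le_lt_trans h2); rewrite ltrD2l; exact: hm.
Qed.

(* Countable form of the infimum over [0, t]. The endpoint [t] is listed
   separately because right continuity does not control it from dyadic times
   at most [t]. *)
Definition dyadic_undershoot (v t : R) : set T :=
  [set w | forall k : nat, Z t w < v + k.+1%:R^-1 \/
    exists m j, dyadic m j <= t /\ Z (dyadic m j) w < v + k.+1%:R^-1].

Lemma measurable_dyadic_undershoot v t : measurable_fun setT (Z t) ->
  measurable (dyadic_undershoot v t).
Proof.
move=> mZt; apply: measurable_forall => k; apply: measurableU.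
  exact: measurable_lt_fun.
apply: measurable_exists => m; apply: measurable_exists => j.
apply: measurable_guard => _; exact: measurable_lt_fun.
Qed.

End Sampling.

Definition undershoot {T : Type} {R : realType} (Z : R -> T -> R) (v t : R) :
    set T :=
  [set w | (ereal_inf [set (Z s w)%:E | s in `[0%R, t]%classic] <= v%:E)%E].

Section Undershoot.
Context {T : Type} {R : realType}.
Implicit Types Z : R -> T -> R.

(** The infimum over an empty time interval is [+oo]. This covers the negative horizons that occur
    because [t] ranges over all reals. *)
Lemma undershoot_lt0 Z v t : t < 0 -> undershoot Z v t = set0.
Proof.
move=> t0; apply/seteqP; split=> // w; rewrite /undershoot /=.
rewrite (_ : [set _ | _ in _] = set0) ?ereal_inf0 //.
apply/seteqP; split=> // y [s /=]; rewrite in_itv /= => /andP[s0 st].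
by move: (le_lt_trans (le_trans s0 st) t0); rewrite ltxx.
Qed.

Lemma le_undershoot Z v s t : s <= t -> undershoot Z v s `<=` undershoot Z v t.
Proof.
move=> st w; apply: le_trans; apply: ereal_inf_le_tmp => y [x /=].
rewrite in_itv /= => /andP[x0 xs] <-; exists x => //=.
by rewrite in_itv /= x0 (le_trans xs).
Qed.

End Undershoot.

Lemma undershootE d (T : measurableType d) (R : realType) (Z : R -> T -> R) v t :
  0 <= t -> (forall w, right_continuous (Z ^~ w)) ->
  undershoot Z v t = dyadic_undershoot Z v t.
Proof.
by move=> t0 cZ; apply/seteqP; split=> w; have [] := inf_le_dyadic v t0 (cZ w).
Qed.

Lemma measurable_undershoot d (T : measurableType d) (R : realType)
    (Z : R -> T -> R) v t :
  (forall s, 0 <= s -> measurable_fun setT (Z s)) ->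
  (forall w, right_continuous (Z ^~ w)) ->
  measurable (undershoot Z v t).
Proof.
move=> mZ cZ; have [t0|t0] := leP 0 t; last by rewrite undershoot_lt0.
rewrite undershootE //; apply: measurable_dyadic_undershoot; last exact: mZ.
by move=> m j; apply: mZ; exact: dyadic_ge0.
Qed.

(** * The right inverse of a path *)

Section HittingTime.
Context {R : realType}.
Implicit Types f : R -> R.

(** Pathwise form of [inverse_process], with the same default value 0 when the level [t] is never
    exceeded. *)
Definition hitting_time f (t : R) : R := inf [set x | 0 <= x /\ t < f x].

Let lb0 f t : lbound [set x | 0 <= x /\ t < f x] 0.
Proof. by move=> x []. Qed.

Lemma hitting_time_ge0 f t : 0 <= hitting_time f t.
Proof.
rewrite /hitting_time; have [->|/set0P nE] := eqVneq [set x | 0 <= x /\ t < f x] set0.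
  by rewrite inf0.
exact: lb_le_inf.
Qed.

Lemma hitting_time_le f t x : 0 <= x -> t < f x -> hitting_time f t <= x.
Proof. by move=> x0 tx; apply: ge_inf; [exists 0|split]. Qed.

Lemma hitting_time_lt f t x : 0 <= x -> t < f x -> forall a, hitting_time f t < a ->
  exists y, [/\ 0 <= y, t < f y & y < a].
Proof.
move=> x0 tx a /inf_lt [|y [y0 ty] ya]; last by exists y.
by exists x.
Qed.

(** The higher level must be exceeded somewhere: otherwise its hitting time is the default 0, which
    could lie below that of [s]. *)
Lemma hitting_time_homo f s t x : s <= t -> 0 <= x -> t < f x ->
  hitting_time f s <= hitting_time f t.
Proof.
move=> st x0 tx; apply: lb_le_inf; first by exists x.
by move=> y [y0 ty]; apply: hitting_time_le => //; exact: le_lt_trans ty.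
Qed.

Lemma hitting_time_unreached f t : (forall x, 0 <= x -> f x <= t) ->
  hitting_time f t = 0.
Proof.
move=> ft; rewrite /hitting_time (_ : mkset _ = set0) ?inf0 //.
by apply/seteqP; split=> // x [x0]; rewrite ltNge ft.
Qed.

(** If [s] is exceeded, some [z] less than [e] after the hitting time has [s < f z], and [z] bounds
    the hitting times of all levels below [f z]. If not, no higher level is exceeded either, and
    both hitting times are the default 0. *)
Lemma hitting_time_near f s e : 0 < e -> exists2 r, 0 < r &
  forall x, s <= x -> x < s + r ->
    hitting_time f s <= hitting_time f x < hitting_time f s + e.
Proof.
move=> e0; have [[y [y0 sy]]|nE] := pselect (exists y, 0 <= y /\ s < f y).
  have se : hitting_time f s < hitting_time f s + e by rewrite ltrDl.
  have [z [z0 sz zs]] := hitting_time_lt y0 sy se.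
  exists (f z - s); first by rewrite subr_gt0.
  move=> x sx; rewrite addrC subrK => xz.
  rewrite (hitting_time_homo sx z0 xz) /=.
  exact: le_lt_trans (hitting_time_le z0 xz) zs.
have fs y : 0 <= y -> f y <= s.
  by move=> y0; rewrite leNgt; apply/negP => sy; apply: nE; exists y.
exists 1 => // x sx _; rewrite !hitting_time_unreached //.
  by rewrite lexx add0r.
by move=> y y0; rewrite (le_trans (fs y y0)).
Qed.

Lemma hitting_time_right_continuous f : right_continuous (hitting_time f).
Proof.
move=> s s0 e e0; have [r r0 hr] := hitting_time_near f s e0.
exists r => // x sx xr; have /andP[h1 h2] := hr x sx xr.
by rewrite ger0_norm ?subr_ge0 // ltrBlDl.
Qed.

Lemma right_continuous_hitting_time f g : right_continuous f ->
  right_continuous (f \o hitting_time g).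
Proof.
move=> cf; apply: right_continuous_comp => //.
- exact: hitting_time_right_continuous.
- by move=> s _; exact: hitting_time_ge0.
- move=> s _; have [r r0 hr] := hitting_time_near g s ltr01.
  by exists r => // x sx xr; have /andP[] := hr x sx xr.
Qed.

(** Strict increase means that the level [f y] is exceeded at every time after [y] and at no time
    before it. *)
Lemma hitting_timeK f y : (forall a b, 0 <= a -> a < b -> f a < f b) ->
  0 <= y -> hitting_time f (f y) = y.
Proof.
move=> incf y0; apply/eqP; rewrite eq_le; apply/andP; split.
  apply/ler_addgt0Pr => e e0; apply: hitting_time_le; first by rewrite addr_ge0 // ltW.
  by apply: incf => //; rewrite ltrDl.
apply: lb_le_inf.
  by exists (y + 1); split; [rewrite addr_ge0|apply: incf => //; rewrite ltrDl].
move=> x [x0 yx]; rewrite leNgt; apply/negP => xy.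
by move: (lt_trans yx (incf _ _ x0 xy)); rewrite ltxx.
Qed.

End HittingTime.

Lemma measurable_inverse_process d (T : measurableType d) (R : realType)
    (L : R -> T -> R) t :
  (forall s, measurable_fun setT (L s)) -> (forall w, nondecreasing_path (L ^~ w)) ->
  measurable_fun setT (inverse_process L t).
Proof.
move=> mL hL; apply: measurable_fun_lt_cst => a.
have mlt s : measurable [set w | t < L s w] by exact: measurable_lt_fun.
(* Either [t] is exceeded before [a], hence by monotonicity at a dyadic time before [a], or it is
   never exceeded and the default 0 lies below [a]. *)
rewrite (_ : mkset _ =
  [set w | exists m j, dyadic m j < a /\ t < L (dyadic m j) w] `|`
  [set w | 0 < a /\ (forall n, L n%:R w <= t)]).
  apply: measurableU.
    apply: measurable_exists => m; apply: measurable_exists => j.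
    by apply: measurable_guard => _; exact: mlt.
  apply: measurable_guard => _; apply: measurable_forall => n.
  exact: measurable_le_fun.
have reach w x : 0 <= x -> t < L x w -> exists n : nat, t < L n%:R w.
  move=> x0 tx; exists (Num.trunc x).+1; apply: (lt_le_trans tx).
  by apply: hL => //; apply: ltW; exact: truncnS_gt.
apply/seteqP; split=> w /=.
  have [[x [x0 tx]] Ya|nE Ya] := pselect (exists x, 0 <= x /\ t < L x w).
    left; have [y [y0 ty ya]] := hitting_time_lt x0 tx Ya.
    have [m [j /andP[h1 h2]]] := dyadic_dense y0 ya.
    exists m, j; split => //; apply: (lt_le_trans ty).
    by apply: hL => //; exact: ltW.
  have Lt x : 0 <= x -> L x w <= t.
    by move=> x0; rewrite leNgt; apply/negP => tx; apply: nE; exists x.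
  right; split; last by move=> n; exact: Lt.
  by rewrite -(hitting_time_unreached Lt).
case=> [[m [j [ja tj]]]|[a0 Lt]].
  exact: le_lt_trans (hitting_time_le (dyadic_ge0 m j) tj) ja.
rewrite [inverse_process _ _ _](_ : _ = 0) //; apply: hitting_time_unreached => x x0.
rewrite leNgt; apply/negP => /(reach _ _ x0)[n].
by rewrite ltNge Lt.
Qed.

(** * Limits of ruin probabilities and regularity of the classical surplus *)

Lemma ruin_probability_cvg d (T : measurableType d) (R : realType)
    (P : probability T R) (Z : R -> T -> R) v :
  (forall s, 0 <= s -> measurable_fun setT (Z s)) ->
  (forall w, right_continuous (Z ^~ w)) ->
  ruin_probability P Z v t @[t --> +oo] --> P (\bigcup_n undershoot Z v n%:R).
Proof.
move=> mZ cZ.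
have mA t : measurable (undershoot Z v t) by exact: measurable_undershoot.
have homo_ruin : {homo ruin_probability P Z v : s t / s <= t >-> (s <= t)%E}.
  move=> s t st; apply: le_measure; rewrite ?inE; [exact: mA|exact: mA|].
  exact: le_undershoot.
have cvg_ruin := nondecreasing_cvge homo_ruin.
have cvg_nat : (P \o (fun n => undershoot Z v n%:R)) n @[n --> \oo] -->
    P (\bigcup_n undershoot Z v n%:R).
  apply: nondecreasing_cvg_mu => //; first exact: bigcupT_measurable.
  by move=> m n mn; apply/subsetPset; apply: le_undershoot; rewrite ler_nat.
(* Monotonicity gives the limit along the reals as a supremum; continuity from below along integer
   horizons identifies its value. *)
suff <- : ereal_sup (range (ruin_probability P Z v)) =
    P (\bigcup_n undershoot Z v n%:R) by [].
apply: (cvg_unique (@ereal_hausdorff R) _ cvg_nat).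
exact: (cvg_comp _ _ (@cvgr_idn R) cvg_ruin).
Qed.

Lemma measurable_risk_process_clock d (T : measurableType d) (R : realType)
    (u mu lambda rho : R) (N : R -> T -> nat) (X : nat -> T -> R) t :
  measurable_fun setT (N t) -> (forall i, measurable_fun setT (X i)) ->
  measurable_fun setT (risk_process u mu lambda rho N identity_clock X t).
Proof.
move=> mN mX; apply: (@measurable_funB _ _ _ _ (cst (u + mu * lambda * (1 + rho) * t))
  (fun w => \sum_(i < N t w) X i w)); first exact: measurable_cst.
apply: (@measurable_fun_random_index _ _ _ (N t) (fun n w => \sum_(i < n) X i w)) => // n.
exact: measurable_sum.
Qed.

Lemma risk_process_clock_right_continuous d (T : measurableType d) (R : realType)
    (u mu lambda rho : R) (N : R -> T -> nat) (X : nat -> T -> R) w :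
  right_continuous (fun t => (N t w)%:R : R) ->
  right_continuous (fun t => risk_process u mu lambda rho N identity_clock X t w).
Proof.
move=> cN s s0 e e0.
(* Natural numbers at distance less than 1 coincide, so tolerance 1 freezes the count, and with it
   the claim sum, just after [s]. Only the linear premium remains. *)
have [r r0 hr] := cN s s0 _ ltr01.
set c := mu * lambda * (1 + rho).
(* Adding 1 keeps the divisor positive when [c = 0]. *)
have c0 : 0 < `|c| + 1 by rewrite ltr_wpDl.
exists (Num.min r (e / (`|c| + 1))); first by rewrite lt_min r0 divr_gt0.
move=> x sx; rewrite -ltrBlDl lt_min => /andP[xr xe].
have NE : N x w = N s w.
  have : `|(N x w)%:R - (N s w)%:R : R| < 1 by apply: hr; rewrite // -ltrBlDl.
  rewrite ltr_norml => /andP[h1 h2]; apply/eqP.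
  rewrite eqn_leq -ltnS -[(N s w <= _)%N]ltnS -!(ltr_nat R) -!natr1.
  by apply/andP; split; lra.
rewrite /risk_process /identity_clock NE -/c.
have -> a : u + c * x - a - (u + c * s - a) = c * (x - s) by lra.
rewrite normrM (ger0_norm (_ : 0 <= x - s)) ?subr_ge0 //.
rewrite ltr_pdivlMr // in xe.
by apply: le_lt_trans xe; rewrite mulrC ler_wpM2l ?subr_ge0 // lerDl.
Qed.

(** * Uniqueness of laws by the pi-lambda theorem *)

Section SameLaw.
Context {d d1 : measure_display} {T : measurableType d} {T1 : measurableType d1}.
Context {R : realType} {S : Type}.
Variables (P : probability T R) (P1 : probability T1 R) (f : T -> S) (g : T1 -> S).

(** Measurability of both preimages is part of the class, so that it is transferred from generators
    together with the equality of probabilities. *)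
Definition same_law : set (set S) :=
  [set A | [/\ measurable (f @^-1` A), measurable (g @^-1` A) &
               P (f @^-1` A) = P1 (g @^-1` A)]].

Lemma same_law_sigma (G : set (set S)) : setI_closed G -> G `<=` same_law ->
  <<s G >> `<=` same_law.
Proof.
move=> IG GS; apply: lambda_system_subset => //.
apply/dynkin_lambda_system; split.
- by split; rewrite !preimage_setT ?probability_setT.
- move=> A [mf mg PA]; split; rewrite -!preimage_setC.
  + exact: measurableC.
  + exact: measurableC.
  + by rewrite !probability_setC // PA.
- move=> F tF SF.
  have mf n : measurable (f @^-1` F n) by case: (SF n).
  have mg n : measurable (g @^-1` F n) by case: (SF n).
  split; rewrite !preimage_bigcup; [exact: bigcupT_measurable..|].
  rewrite !measure_bigcup //; first last.
  + by move/trivIsetP : tF => tF; apply/trivIsetP => i j _ _ ij;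
      rewrite -preimage_setI tF ?preimage_set0.
  + by move/trivIsetP : tF => tF; apply/trivIsetP => i j _ _ ij;
      rewrite -preimage_setI tF ?preimage_set0.
  + by apply: eq_eseriesr => n _; case: (SF n).
Qed.

End SameLaw.

Lemma measurable_sigma_family (T : pointedType) d' (T' : measurableType d')
    (I : Type) (D : set I) (X : I -> T -> T') (i : I) : D i ->
  measurable_fun setT (X i : g_sigma_algebraType
    (\bigcup_(i in D) g_sigma_algebra_preimage (X i)) -> T').
Proof.
move=> Di _ B mB; apply: sub_sigma_algebra; exists i => //.
by exists B.
Qed.

Lemma measurable_natr_comp d (T : measurableType d) (R : realType) (f : T -> nat) :
  measurable_fun setT f <-> measurable_fun setT (fun w => (f w)%:R : R).
Proof.
split=> mf; first exact: (measurableT_comp (f := fun n : nat => n%:R : R)).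
rewrite (_ : f = fun w => Num.trunc ((f w)%:R : R)).
  exact: measurable_fun_truncn.
by apply/funext => w; rewrite natrK.
Qed.

(** * Sigma-algebras of dyadic increments and claims on path space *)

Section Cylinders.
Context {R : realType}.

Definition dyadic_increment (N : R -> nat) (m j : nat) : R :=
  (N (dyadic m j.+1))%:R - (N (dyadic m j))%:R.

Definition path_space : pointedType := ((R -> nat) * (nat -> R))%type.

(* Increments determine a counting path only up to its value at 0, which is not
   fixed in [path_space]; hence the extra constraint [C0]. *)
Definition cylinder (m K : nat) (C0 : set nat) (C B : nat -> set R) : set path_space :=
  [set p | [/\ C0 (p.1 0),
     forall j, (j < K)%N -> C j (dyadic_increment p.1 m j) &
     forall i, (i < K)%N -> B i (p.2 i)]].

Definition cylinders (m : nat) : set (set path_space) :=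
  [set A | exists K C0 C B, [/\ forall j, measurable (C j),
     forall i, measurable (B i) & A = cylinder m K C0 C B]].

Lemma cylinders_setI m : setI_closed (cylinders m).
Proof.
move=> _ _ [K [C0 [C [B [mC mB ->]]]]] [K' [C0' [C' [B' [mC' mB' ->]]]]].
exists (K + K')%N, (C0 `&` C0').
(* The common length [K + K'] exceeds both ranges; the guards make each constraint void beyond its
   own range. *)
exists (fun j => [set x | (j < K)%N -> C j x] `&` [set x | (j < K')%N -> C' j x]).
exists (fun j => [set x | (j < K)%N -> B j x] `&` [set x | (j < K')%N -> B' j x]).
split.
- by move=> j; apply: measurableI; apply: measurable_implies.
- by move=> j; apply: measurableI; apply: measurable_implies.
- apply/seteqP; split=> p.
    by move=> [[p1 p2 p3] [q1 q2 q3]]; split => // j _; split=> jK; auto.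
  move=> [[p1 q1] pC pB]; split; split=> // j jK.
  + by apply: (pC j _).1 => //; exact: ltn_addr.
  + by apply: (pB j _).1 => //; exact: ltn_addr.
  + by apply: (pC j _).2 => //; exact: ltn_addl.
  + by apply: (pB j _).2 => //; exact: ltn_addl.
Qed.

Lemma measurable_cylinder d (T : measurableType d) (N : R -> T -> nat)
    (X : nat -> T -> R) m A :
  (forall j, measurable_fun setT (N (dyadic m j))) ->
  (forall i, measurable_fun setT (X i)) ->
  cylinders m A -> measurable [set w | A (N ^~ w, X ^~ w)].
Proof.
move=> mN mX [K [C0 [C [B [mC mB ->]]]]].
rewrite (_ : mkset _ = N 0 @^-1` C0 `&`
  ([set w | forall j, (j < K)%N -> C j (dyadic_increment (N ^~ w) m j)] `&`
  [set w | forall i, (i < K)%N -> B i (X i w)])); last first.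
  by apply/seteqP; split=> w [? // [? ?]].
apply: measurableI.
  by rewrite -[X in measurable X]setTI -(dyadic0 m); exact: mN.
apply: measurableI; apply: measurable_forall => j; apply: measurable_implies => _;
  rewrite -[X in measurable X]setTI.
  apply: (_ : measurable_fun setT (fun w => dyadic_increment (N ^~ w) m j)) => //.
  by apply: measurable_funB; apply/measurable_natr_comp.
exact: mX.
Qed.

Let level m := g_sigma_algebraType (cylinders m).

Let full_cylinder m K C0 C B : (forall j, measurable (C j)) ->
  (forall i, measurable (B i)) -> cylinders m (cylinder m K C0 C B).
Proof. by move=> mC mB; exists K, C0, C, B. Qed.

Let only (i : nat) (B : set R) (j : nat) : set R := [set x | j = i -> B x].

Let measurable_only i B j : measurable B -> measurable (only i B j).
Proof. by move=> mB; exact: measurable_implies. Qed.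

Lemma measurable_claim m i : measurable_fun setT (fun p : level m => p.2 i).
Proof.
move=> _ B mB; rewrite setTI.
rewrite (_ : _ @^-1` _ = cylinder m i.+1 setT (fun=> setT) (only i B)).
  by apply: sub_sigma_algebra; apply: full_cylinder => // j; exact: measurable_only.
apply/seteqP; split=> p /=; first by move=> Bp; split=> // j _ ->.
by case=> _ _ /(_ i (ltnSn i)); exact.
Qed.

Let measurable_increment m j :
  measurable_fun setT (fun p : level m => dyadic_increment p.1 m j).
Proof.
move=> _ B mB; rewrite setTI.
rewrite (_ : _ @^-1` _ = cylinder m j.+1 setT (only j B) (fun=> setT)).
  by apply: sub_sigma_algebra; apply: full_cylinder => // i; exact: measurable_only.
apply/seteqP; split=> p /=; first by move=> Bp; split=> // i _ ->.
by case=> _ /(_ j (ltnSn j)) + _; exact.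
Qed.

(** A count is the value at 0, read off by [C0], plus the successive increments; hence the induction
    on [j]. *)
Lemma measurable_count m j : measurable_fun setT (fun p : level m => p.1 (dyadic m j)).
Proof.
apply/(@measurable_natr_comp _ _ R); elim: j => [|j IHj].
  apply/measurable_natr_comp => _ C0 _; rewrite setTI.
  rewrite (_ : _ @^-1` _ = cylinder m 0 C0 (fun=> setT) (fun=> setT)).
    by apply: sub_sigma_algebra; exact: full_cylinder.
  by apply/seteqP; split=> p; rewrite /cylinder /= dyadic0 // => -[].
rewrite (_ : (fun _ => _) = fun p : level m =>
    dyadic_increment p.1 m j + (p.1 (dyadic m j))%:R); first exact: measurable_funD.
by apply/funext => p; rewrite /dyadic_increment subrK.
Qed.

(** Times of level [l] are the even-indexed times of level [l + 1], so the coarse coordinates are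
    measurable for the finer sigma-algebra. *)
Lemma cylinders_nested m n : (m <= n)%N -> <<s cylinders m >> `<=` <<s cylinders n >>.
Proof.
move=> /subnKC <-; elim: (n - m)%N => [|k IHk]; first by rewrite addn0.
apply: (subset_trans IHk); rewrite addnS.
apply: smallest_sub; first exact: smallest_sigma_algebra.
move=> A cA; set l := (m + k)%N in cA *.
(* Path space serves here as its own sample space, with the coordinate maps as processes. *)
have := @measurable_cylinder _ (level l.+1) (fun t p => p.1 t) (fun i p => p.2 i) l A.
rewrite [X in measurable X](_ : _ = A); last by apply/seteqP; split=> -[].
apply => //; last exact: measurable_claim.
by move=> j; rewrite -dyadicSl; exact: measurable_count.
Qed.

(** The generator is a union of sigma-algebras rather than of cylinders: cylinders of different
    levels need not intersect in a cylinder, whereas nested sigma-algebras have a union closed under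
    intersection. *)
Definition dyadic_paths := g_sigma_algebraType (\bigcup_m <<s cylinders m >>).

Lemma level_dyadic_paths m : <<s cylinders m >> `<=` (measurable : set (set dyadic_paths)).
Proof. by move=> A mA; apply: sub_sigma_algebra; exists m. Qed.

Lemma dyadic_paths_setI : setI_closed (\bigcup_m <<s cylinders m >>).
Proof.
move=> A B [m _ mA] [n _ mB]; exists (maxn m n) => //.
apply: (@measurableI _ (level (maxn m n))).
  by apply: cylinders_nested mA; exact: leq_maxl.
by apply: cylinders_nested mB; exact: leq_maxr.
Qed.

Lemma measurable_dyadic_paths_claim i : measurable_fun setT (fun p : dyadic_paths => p.2 i).
Proof.
by move=> _ B mB; apply: (@level_dyadic_paths 0); exact: measurable_claim.
Qed.

Lemma measurable_dyadic_paths_count m j :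
  measurable_fun setT (fun p : dyadic_paths => p.1 (dyadic m j)).
Proof.
by move=> _ B mB; apply: (@level_dyadic_paths m); exact: measurable_count.
Qed.

End Cylinders.

(** * Product formula for cylinder probabilities *)

Section CylinderProbability.
Context {d : measure_display} {T : measurableType d} {R : realType}.
Variables (P : probability T R) (lambda : R).
Variables (N : R -> {RV P >-> nat}) (X : nat -> {RV P >-> R}).

Lemma mutually_independent_prefix (Y : nat -> T -> R) (K : nat) (B : nat -> set R) :
  mutually_independent P (fun (i : 'I_K) => Y i) -> (forall i, measurable (B i)) ->
  P [set w | forall i, (i < K)%N -> B i (Y i w)] = (\prod_(i < K) P (Y i @^-1` B i))%E.
Proof.
move=> indY mB.
have := indY (index_enum 'I_K) (fun i => B i) (index_enum_uniq _) (fun i => mB i).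
move=> <-; congr (P _); apply/seteqP; split=> w /=.
  by move=> h i _; exact: h.
by move=> h i iK; apply: (h (Ordinal iK)); rewrite /= mem_index_enum.
Qed.

(** The right-hand side involves only [lambda], [t - s] and [B], so increments have equal laws in
    any two models with the same rate. *)
Lemma poisson_increment_probability s t (B : set R) :
  poisson_process lambda N -> 0 <= s -> s < t ->
  P ((fun w => (N t w)%:R - (N s w)%:R) @^-1` B) =
  (\sum_(0 <= k <oo | k \in [set k : nat | B k%:R])
     (poisson_pmf (lambda * (t - s)) k)%:E)%E.
Proof.
move=> [_ ndN _ _ pN] s0 st.
have mN r : measurable_fun setT (N r : T -> nat) by [].
rewrite (_ : _ @^-1` _ = \bigcup_(k in [set k : nat | B k%:R])
    [set w | N t w = (N s w + k)%N]); last first.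
  apply/seteqP; split=> w /=.
    (* Monotone paths make the real difference a natural number, and the event splits according to
       its value [k]. *)
    move=> Bw; have le_N : (N s w <= N t w)%N.
      by rewrite -(ler_nat R); apply: ndN => //; exact: ltW.
    exists (N t w - N s w)%N; rewrite /= ?natrB //.
    by rewrite subnKC.
  by move=> [k /= Bk ->]; rewrite natrD addrAC subrr add0r.
rewrite measure_bigcup; last 2 first.
- move=> k _; rewrite (_ : mkset _ =
    [set w | exists n, N s w = n /\ N t w = (n + k)%N]).
    apply: measurable_exists => n; apply: measurableI.
      by rewrite -[X in measurable X]setTI; exact: (mN s measurableT [set n]).
    by rewrite -[X in measurable X]setTI; exact: (mN t measurableT [set (n + k)%N]).
  by apply/seteqP; split=> w /= => [|[n [<-]]//]; exists (N s w).
- apply/trivIsetP => i j _ _ /eqP ij; apply/seteqP; split=> // w /= [->].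
  by move/addnI.
by apply: eq_eseriesr => k _; exact: pN.
Qed.

(** Independence of claims and counts separates the two blocks of constraints; each block then
    factors by mutual independence. The constraint [C0] holds surely because counts start at 0. *)
Lemma cylinder_probability m K (C0 : set nat) (C B : nat -> set R) :
  poisson_process lambda N -> iid X ->
  independent_systems P (sigma_family setT (fun i => X i : T -> R))
    (sigma_family [set t : R | 0 <= t] (fun t => N t : T -> nat)) ->
  C0 0%N -> (forall j, measurable (C j)) -> (forall i, measurable (B i)) ->
  P [set w | cylinder m K C0 C B (N ^~ w, X ^~ w)] =
  ((\prod_(i < K) P (X i @^-1` B i)) *
   \prod_(j < K) P ((fun w => dyadic_increment (N ^~ w) m j) @^-1` C j))%E.
Proof.
move=> [N0 _ _ indN _] [indX _] indXN C00 mC mB.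
rewrite (_ : [set w | _] = [set w | forall i, (i < K)%N -> B i (X i w)] `&`
  [set w | forall j, (j < K)%N -> C j (dyadic_increment (N ^~ w) m j)]); last first.
  by apply/seteqP; split=> w /=; [case=> _|move=> [? ?]; split=> //; rewrite /= N0].
rewrite indXN.
- congr (_ * _)%E.
    have := indX (index_iota 0 K) B (iota_uniq _ _) mB; rewrite big_mkord => <-.
    congr (P _); apply/seteqP; split=> w h i.
      by rewrite /= mem_index_iota; exact: h.
    by move=> iK; apply: h; rewrite /= mem_index_iota.
  rewrite (mutually_independent_prefix (Y := fun j w => dyadic_increment (N ^~ w) m j)) //.
  apply: (indN K (fun j => dyadic m j)); first exact: dyadic_ge0.
  by move=> i j; exact: dyadic_le.
(* It remains to place each block in its generated sigma-algebra, done by taking that sigma-algebra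
   as the measurable structure on [T]. *)
- rewrite /sigma_family; set G := \bigcup_(_ in _) _.
  apply: (@measurable_forall _ (g_sigma_algebraType G)) => i.
  apply: measurable_implies => _; rewrite -[X in measurable X]setTI.
  exact: (measurable_sigma_family (X := fun i => X i : T -> R)).
- rewrite /sigma_family; set G := \bigcup_(_ in _) _.
  apply: (@measurable_forall _ (g_sigma_algebraType G)) => j.
  apply: measurable_implies => _; rewrite -[X in measurable X]setTI.
  suff mD : measurable_fun setT
      (fun w : g_sigma_algebraType G => dyadic_increment (N ^~ w) m j) by exact: mD.
  apply: measurable_funB; apply/measurable_natr_comp;
    by apply: (measurable_sigma_family (X := fun t => N t : T -> nat)); exact: dyadic_ge0.
Qed.

End CylinderProbability.

(** * Equality of the laws in the two models *)

Section Law.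
Context {d d1 : measure_display} {T : measurableType d} {T1 : measurableType d1}.
Context {R : realType}.
Variables (P : probability T R) (P1 : probability T1 R) (lambda : R).
Variables (N : R -> {RV P >-> nat}) (X : nat -> {RV P >-> R}).
Variables (N1 : R -> {RV P1 >-> nat}) (X1 : nat -> {RV P1 >-> R}).
Hypotheses (hN : poisson_process lambda N) (hN1 : poisson_process lambda N1).
Hypotheses (hX : iid X) (hX1 : iid X1).
Hypothesis indXN : independent_systems P
  (sigma_family setT (fun i => X i : T -> R))
  (sigma_family [set t : R | 0 <= t] (fun t => N t : T -> nat)).
Hypothesis indXN1 : independent_systems P1
  (sigma_family setT (fun i => X1 i : T1 -> R))
  (sigma_family [set t : R | 0 <= t] (fun t => N1 t : T1 -> nat)).
Hypothesis hXX1 : forall B : set R, measurable B ->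
  distribution P (X 0%N) B = distribution P1 (X1 0%N) B.

(** The pi-lambda argument runs twice: first from all levels together down to one level, then from
    that level down to its cylinders, where the product formula applies. *)
Lemma same_law_dyadic_paths : (measurable : set (set (@dyadic_paths R))) `<=`
  same_law P P1 (fun w => (N ^~ w, X ^~ w) : path_space)
    (fun w => (N1 ^~ w, X1 ^~ w) : path_space).
Proof.
apply: same_law_sigma; first exact: dyadic_paths_setI.
move=> A [m _]; apply: same_law_sigma; first exact: cylinders_setI.
move=> {}A cA; split.
- exact: (measurable_cylinder (N := fun t => N t) (X := fun i => X i) _ _ cA).
- exact: (measurable_cylinder (N := fun t => N1 t) (X := fun i => X1 i) _ _ cA).
move: cA => [K [C0 [C [B [mC mB ->]]]]].
(* Counts start at 0 in both models, so a cylinder whose [C0] excludes 0 has empty preimages. *)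
have [C00|C0N] := pselect (C0 0%N); last first.
  rewrite (_ : _ @^-1` _ = set0); last first.
    apply/seteqP; split=> // w [] /=.
    by case: hN => -> _ _ _ _ /C0N.
  rewrite (_ : _ @^-1` _ = set0) ?measure0 //.
  apply/seteqP; split=> // w [] /=.
  by case: hN1 => -> _ _ _ _ /C0N.
transitivity (P [set w | cylinder m K C0 C B (N ^~ w, X ^~ w)]); first by [].
rewrite (cylinder_probability m K hN hX indXN C00 mC mB).
transitivity (P1 [set w | cylinder m K C0 C B (N1 ^~ w, X1 ^~ w)]); last by [].
rewrite (cylinder_probability m K hN1 hX1 indXN1 C00 mC mB).
congr (_ * _)%E; apply: eq_bigr => i _.
  case: hX => _ /(_ i _ (mB i)); rewrite /distribution /pushforward => ->.
  case: hX1 => _ /(_ i _ (mB i)); rewrite /distribution /pushforward => ->.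
  exact: hXX1.
have lt_i : dyadic m i < dyadic m i.+1 :> R by apply: dyadic_lt.
rewrite /dyadic_increment.
rewrite (poisson_increment_probability _ hN (dyadic_ge0 m i) lt_i).
by rewrite (poisson_increment_probability _ hN1 (dyadic_ge0 m i) lt_i).
Qed.

Lemma ultimate_undershoot_law (u mu rho v : R) :
  P (\bigcup_n undershoot (risk_process u mu lambda rho (fun t => N t : T -> nat)
       identity_clock (fun i => X i : T -> R)) v n%:R) =
  P1 (\bigcup_n undershoot (risk_process u mu lambda rho (fun t => N1 t : T1 -> nat)
       identity_clock (fun i => X1 i : T1 -> R)) v n%:R).
Proof.
pose Z : R -> @dyadic_paths R -> R := risk_process u mu lambda rho
  (fun t (p : dyadic_paths) => p.1 t) identity_clock
  (fun i (p : dyadic_paths) => p.2 i).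
have mZ m j : measurable_fun setT (Z (dyadic m j)).
  apply: measurable_risk_process_clock; first exact: measurable_dyadic_paths_count.
  exact: measurable_dyadic_paths_claim.
(* Points of [dyadic_paths] are arbitrary functions, without right continuity. The countable event
   is therefore compared there, and identified with [undershoot] only along the paths of the two
   models. *)
pose U : set (@dyadic_paths R) := \bigcup_n dyadic_undershoot Z v n%:R.
have mU : measurable U.
  apply: bigcupT_measurable => n; apply: measurable_dyadic_undershoot => //.
  (* The integer endpoint of the horizon is a dyadic time of level 0. *)
  by rewrite -dyadic_nat.
have [_ _] := same_law_dyadic_paths mU.
rewrite !preimage_bigcup => PU; etransitivity; last etransitivity; last 2 first.
- exact: PU.
- congr (P1 _); apply: eq_bigcupr => n _; rewrite undershootE // => w.
  apply: risk_process_clock_right_continuous; apply: cadlag_right_continuous.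
  by case: hN1.
congr (P _); apply: eq_bigcupr => n _; rewrite undershootE // => w.
apply: risk_process_clock_right_continuous; apply: cadlag_right_continuous.
by case: hN.
Qed.

End Law.

(** * Null sets and almost sure path properties of the stable subordinator *)

Section NullSets.
Context {d : measure_display} {T : measurableType d} {R : realType}.
Variable P : probability T R.

Lemma null_exists (A : nat -> set T) : (forall n, measurable (A n) /\ P (A n) = 0%E) ->
  measurable [set w | exists n, A n w] /\ P [set w | exists n, A n w] = 0%E.
Proof.
move=> A0; have mA : measurable [set w | exists n, A n w].
  by apply: measurable_exists => n; case: (A0 n).
split=> //; apply/negligibleP => //.
rewrite (_ : mkset _ = \bigcup_n A n).
  apply: negligible_bigcup => n; have [mAn An0] := A0 n.
  exact/negligibleP.
by apply/seteqP; split=> w [n]; [exists n|move=> _; exists n].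
Qed.

Lemma null_guard (Q : Prop) (A : set T) : (Q -> measurable A /\ P A = 0%E) ->
  measurable [set w | Q /\ A w] /\ P [set w | Q /\ A w] = 0%E.
Proof.
move=> A0; have [q|nq] := pselect Q.
  rewrite (_ : mkset _ = A); first exact: A0.
  by apply/seteqP; split=> w; [case|].
rewrite (_ : mkset _ = set0); first by rewrite measure0.
by apply/seteqP; split=> w //; case.
Qed.

Lemma eq_measure_off_null (A B D : set T) : measurable A -> measurable B ->
  measurable D -> P D = 0%E -> (forall w, ~ D w -> A w <-> B w) -> P A = P B.
Proof.
have le A' B' : measurable A' -> measurable B' -> measurable D -> P D = 0%E ->
    (forall w, ~ D w -> A' w -> B' w) -> (P A' <= P B')%E.
  move=> mA mB mD D0 AB; apply: (@le_trans _ _ (P (B' `|` D))).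
    apply: le_measure; rewrite ?inE //; first exact: measurableU.
    by move=> w Aw; have [Dw|nD] := pselect (D w); [right|left; exact: AB].
  by apply: (le_trans (measureU2 _ mB mD)); rewrite [X in (_ + X)%E]D0 adde0.
move=> mA mB mD D0 AB; apply/eqP; rewrite eq_le.
by rewrite !le // => w /AB [].
Qed.

End NullSets.

Section StableSubordinator.
Context {d : measure_display} {T : measurableType d} {R : realType}.
Variables (P : probability T R) (alpha : R) (L : R -> {RV P >-> R}).
Hypothesis hL : stable_subordinator alpha L.

(** Exponential Markov inequality for [- L t], whose moment generating function at [s] is the
    Laplace transform of [L t]. *)
Lemma subordinator_chernoff s t a : 0 < s -> 0 <= t ->
  (P [set w | (L t w <= a)%R] <= (expR (s * a - t * s `^ alpha))%:E)%E.
Proof.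
move=> s0 t0; have [_ _ /(_ _ _ (ltW s0) t0) EL] := hL.
have := chernoff (- L t : {RV P >-> R}) (- a) s0.
rewrite (_ : [set x | _] = [set w | L t w <= a]); last first.
  by apply/seteqP; split=> w /=; rewrite lerN2.
move=> /le_trans; apply.
rewrite /mmt_gen_fun (_ : expR \o _ = fun w => expR (- s * L t w)); last first.
  apply/funext => w; transitivity (expR (- L t w * s)) => //.
  by rewrite !mulNr mulrC.
by rewrite EL -EFinM lee_fin -expRD mulrN opprK mulNr addrC.
Qed.

End StableSubordinator.

Lemma null_of_expR_bound d (T : measurableType d) (R : realType)
    (P : probability T R) (A : set T) (a : R) : measurable A ->
  (forall n : nat, (P A <= (expR (a - n.+1%:R))%:E)%E) -> P A = 0%E.
Proof.
move=> mA PA; apply/eqP; rewrite eq_le measure_ge0 andbT.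
apply/lee_addgt0Pr => e e0; rewrite add0e.
(* This index [n] satisfies [a - (n + 1) < ln e]. *)
apply: (le_trans (PA (Num.trunc (a - ln e)))); rewrite lee_fin.
rewrite -[leRHS]lnK ?posrE // ler_expR.
by have := truncnS_gt (a - ln e); lra.
Qed.

Section StablePaths.
Context {d : measure_display} {T : measurableType d} {R : realType}.
Variables (P : probability T R) (alpha : R) (L : R -> {RV P >-> R}).
Hypothesis halpha : 0 < alpha < 1.
Hypothesis hL : stable_subordinator alpha L.

Let mL t : measurable_fun setT (L t : T -> R). Proof. by []. Qed.

(** By stationarity the probability is that of [L (t - s) <= 0], which the Chernoff bound at level 0
    puts below [exp (- (n + 1))] for every [n]. *)
Lemma subordinator_flat_null s t : 0 <= s -> s < t ->
  measurable [set w | L t w <= L s w] /\ P [set w | L t w <= L s w] = 0%E.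
Proof.
move=> s0 st; have mA : measurable [set w | L t w <= L s w] by exact: measurable_le_fun.
split=> //; apply: (@null_of_expR_bound _ _ _ _ _ 0) => // n.
have h0 : 0 < t - s by rewrite subr_gt0.
have stE : s + (t - s) = t by rewrite addrC subrK.
have x0 : 0 < n.+1%:R / (t - s) by rewrite divr_gt0.
(* The Chernoff parameter [y] is the solution of [(t - s) y^alpha = n + 1]. *)
have y0 : 0 < (n.+1%:R / (t - s)) `^ alpha^-1 by rewrite powR_gt0.
have [[_ _ _ stat] _ _] := hL.
have := stat s (t - s) `]-oo, 0]%classic s0 (ltW h0) (measurable_itv _).
rewrite (_ : _ @^-1` _ = [set w | L t w <= L s w]); last first.
  by apply/seteqP; split=> w /=; rewrite in_itv /= stE subr_le0.
rewrite (_ : L (t - s) @^-1` _ = [set w | L (t - s) w <= 0]); last first.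
  by apply/seteqP; split=> w /=; rewrite in_itv.
move=> ->; apply: (le_trans (subordinator_chernoff hL 0 y0 (ltW h0))).
have /andP[a0 _] := halpha.
rewrite lee_fin mulr0 -powRrM mulVf ?gt_eqF // powRr1 ?(ltW x0) //.
by rewrite mulrC divfK ?gt_eqF.
Qed.

(** The event implies [L (n + 1) <= M], of probability at most [exp (M - (n + 1))] by the Chernoff
    bound with parameter 1. *)
Lemma subordinator_bounded_null (M : nat) :
  measurable [set w | forall n : nat, L n%:R w <= M%:R] /\
  P [set w | forall n : nat, L n%:R w <= M%:R] = 0%E.
Proof.
have mA : measurable [set w | forall n : nat, L n%:R w <= M%:R].
  by apply: measurable_forall => n; exact: measurable_le_fun.
split=> //; apply: (@null_of_expR_bound _ _ _ _ _ M%:R) => // n.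
apply: (@le_trans _ _ (P [set w | L n.+1%:R w <= M%:R])).
  apply: le_measure; rewrite ?inE //; first exact: measurable_le_fun.
  by move=> w /(_ n.+1).
apply: (le_trans (subordinator_chernoff hL _ ltr01 (ler0n _ _))).
by rewrite mul1r powR1 mulr1.
Qed.

(** Restricting to dyadic and integer times leaves countably many null events; monotonicity recovers
    strict increase at all times. *)
Definition degenerate_paths : set T :=
  [set w | exists m i n j, dyadic m i < dyadic n j :> R /\
     L (dyadic n j) w <= L (dyadic m i) w] `|`
  [set w | exists M : nat, forall n : nat, L n%:R w <= M%:R].

Lemma degenerate_paths_null : measurable degenerate_paths /\ P degenerate_paths = 0%E.
Proof.
have [mA A0] : measurable [set w | exists m i n j, dyadic m i < dyadic n j :> R /\
     L (dyadic n j) w <= L (dyadic m i) w] /\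
   P [set w | exists m i n j, dyadic m i < dyadic n j :> R /\
     L (dyadic n j) w <= L (dyadic m i) w] = 0%E.
  apply: null_exists => m; apply: null_exists => i; apply: null_exists => n.
  apply: null_exists => j; apply: null_guard => ij.
  by apply: subordinator_flat_null => //; exact: dyadic_ge0.
have [mB B0] := null_exists subordinator_bounded_null.
split; first exact: measurableU.
apply/eqP; rewrite -measure_le0; apply: (le_trans (measureU2 _ mA mB)).
by rewrite [X in (X + _)%E]A0 [X in (_ + X)%E]B0 adde0.
Qed.

Lemma nondegenerate_increasing w : ~ degenerate_paths w ->
  forall a b, 0 <= a -> a < b -> L a w < L b w.
Proof.
move=> nD a b a0 ab; have [_ ndL _] := hL.
(* Two dyadic times are inserted between [a] and [b]: the strict rise occurs between them, and
   monotonicity covers both ends. *)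
have [m [i /andP[ai ib]]] := dyadic_dense a0 ab.
have [n [j /andP[ij jb]]] := dyadic_dense (dyadic_ge0 m i) ib.
apply: (le_lt_trans (ndL w _ _ a0 (ltW ai))).
apply: lt_le_trans (ndL w _ _ (dyadic_ge0 n j) (ltW jb)).
by rewrite ltNge; apply/negP => Lij; apply: nD; left; exists m, i, n, j.
Qed.

Lemma nondegenerate_unbounded w : ~ degenerate_paths w ->
  forall M : nat, exists n : nat, M%:R < L n%:R w.
Proof.
move=> nD M; apply: contrapT => nE; apply: nD; right; exists M => n.
by rewrite leNgt; apply/negP => Mn; apply: nE; exists n.
Qed.

End StablePaths.

(* The clock is onto [0, +oo[ because time [L y w] is mapped to [y]. *)
Lemma ultimate_undershoot_hitting_time (T : Type) (R : realType) (L Z : R -> T -> R)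
    (w : T) (v : R) : L 0 w = 0 -> (forall a b, 0 <= a -> a < b -> L a w < L b w) ->
  (forall M : nat, exists n : nat, M%:R < L n%:R w) ->
  (\bigcup_n undershoot (fun t w => Z (hitting_time (L ^~ w) t) w) v n%:R) w <->
  (\bigcup_n undershoot Z v n%:R) w.
Proof.
move=> L0 incL unbL; split=> -[n _ nv].
  have [k nk] := unbL n; exists k => //; apply: le_trans nv.
  apply: ereal_inf_le_tmp => y [s /=]; rewrite in_itv /= => /andP[s0 sn] <-.
  exists (hitting_time (L ^~ w) s) => //=; rewrite in_itv /= hitting_time_ge0 /=.
  by apply: hitting_time_le => //; exact: le_lt_trans nk.
(* This horizon exceeds [L n], hence all times [L s] with [s <= n], at which the clock shows [s]. *)
exists (Num.trunc (L n%:R w)).+1 => //; apply: le_trans nv.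
apply: ereal_inf_le_tmp => y [s /=]; rewrite in_itv /= => /andP[s0 sn] <-.
have leL a b : 0 <= a -> a <= b -> L a w <= L b w.
  by move=> a0; rewrite le_eqVlt => /orP[/eqP ->//|ab]; apply: ltW; exact: incL.
exists (L s w); last by rewrite hitting_timeK.
rewrite /= in_itv /= -[X in X <= _ <= _]L0 leL //=.
exact: (le_trans (leL _ _ s0 sn) (ltW (truncnS_gt _))).
Qed.

Theorem lemma12 (R : realType) (alpha lambda mu u rho : R)
    (halpha : 0 < alpha < 1) (hlambda : 0 < lambda) (hmu : 0 < mu)
    (hu : 0 < u) (hrho : 0 <= rho)
    (d : measure_display) (T : measurableType d) (P : probability T R)
    (L : R -> {RV P >-> R}) (N : R -> {RV P >-> nat})
    (X : nat -> {RV P >-> R})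
    (hL : stable_subordinator alpha L)
    (hfrac : risk_model lambda mu N (inverse_process (fun t => L t : T -> R)) X)
    (d1 : measure_display) (T1 : measurableType d1) (P1 : probability T1 R)
    (N1 : R -> {RV P1 >-> nat}) (X1 : nat -> {RV P1 >-> R})
    (hclass : risk_model lambda mu N1 (@identity_clock _ T1 R) X1)
    (hclaims : forall B : set R, measurable B ->
       distribution P (X 0%N) B = distribution P1 (X1 0%N) B)
    (v : R) :
  let R_alpha := risk_process u mu lambda rho (fun t => N t : T -> nat)
    (inverse_process (fun t => L t : T -> R)) (fun i => X i : T -> R) in
  let R_1 := risk_process u mu lambda rho (fun t => N1 t : T1 -> nat)
    (@identity_clock _ T1 R) (fun i => X1 i : T1 -> R) in
  [/\ cvg (ruin_probability P R_alpha v t @[t --> +oo]),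
      cvg (ruin_probability P1 R_1 v t @[t --> +oo]) &
      lim (ruin_probability P R_alpha v t @[t --> +oo]) =
      lim (ruin_probability P1 R_1 v t @[t --> +oo])].
Proof.
move=> R_alpha R_1.
have [hN _ hX _ indX] := hfrac.
have [hN1 _ hX1 _ indX1] := hclass.
have [[L0 _ _ _] ndL _] := hL.
(* The bridge between the models: it lives on the fractional probability space but runs on the
   classical clock, and [R_alpha] is [C] sampled at the inverse of [L]. *)
pose C := risk_process u mu lambda rho (fun t => N t : T -> nat) identity_clock
  (fun i => X i : T -> R).
have mC s : measurable_fun setT (C s) by exact: measurable_risk_process_clock.
have cC w : right_continuous (C ^~ w).
  apply: risk_process_clock_right_continuous; apply: cadlag_right_continuous.
  by case: hN.
have mR1 s : measurable_fun setT (R_1 s) by exact: measurable_risk_process_clock.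
have cR1 w : right_continuous (R_1 ^~ w).
  apply: risk_process_clock_right_continuous; apply: cadlag_right_continuous.
  by case: hN1.
have mRa s : measurable_fun setT (R_alpha s).
  apply: (@measurable_sample _ _ _ C) => //; last exact: measurable_inverse_process.
  by move=> w; exact: hitting_time_ge0.
have cRa w : right_continuous (R_alpha ^~ w).
  exact: right_continuous_hitting_time (L ^~ w) (cC w).
have cvg_alpha := ruin_probability_cvg (P := P) (v := v) (fun s _ => mRa s) cRa.
have cvg_1 := ruin_probability_cvg (P := P1) (v := v) (fun s _ => mR1 s) cR1.
have eq_limits : P (\bigcup_n undershoot R_alpha v n%:R) =
    P1 (\bigcup_n undershoot R_1 v n%:R).
  (* First the clock is removed pathwise off a null set, then the probability space is changed by
     equality of laws. *)
  transitivity (P (\bigcup_n undershoot C v n%:R)).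
    have [mD D0] := degenerate_paths_null halpha hL.
    apply: (eq_measure_off_null _ _ mD D0).
    - by apply: bigcupT_measurable => n; exact: measurable_undershoot.
    - by apply: bigcupT_measurable => n; exact: measurable_undershoot.
    - move=> w nD; apply: (ultimate_undershoot_hitting_time (L := fun t => L t) C v (L0 w)).
        exact: (nondegenerate_increasing hL nD).
      exact: nondegenerate_unbounded nD.
  apply: ultimate_undershoot_law => //.
  (* Independence from the pair of counts and clock restricts to the counts alone. *)
  - by move=> A B sA sB; apply: indX => //; apply: sub_sigma_algebra; left.
  - by move=> A B sA sB; apply: indX1 => //; apply: sub_sigma_algebra; left.
split; [exact: cvgP cvg_alpha|exact: cvgP cvg_1|].
by rewrite (cvg_lim _ cvg_alpha) // (cvg_lim _ cvg_1).
Qed.
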